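(* There is no binary multioperation $\Rightarrow\colon\mathcal V_6\times\mathcal V_6\to\wp(\mathcal V_6)$ such that, writing $\mathbf{PP}_6^{\Rightarrow}$ for the expansion of $\mathbf{PP}_6$ by $\Rightarrow$ (interpreting a new binary connective $\Rightarrow$), both of the following hold: (A1) for all $a,b\in\mathcal V_6$: $a\Rightarrow b\subseteq{\uparrow}\mathbf b$ if and only if ($a\notin{\uparrow}\mathbf b$ or $b\in{\uparrow}\mathbf b$); (A2) the Set-Set logic determined by the PNmatrix $\langle\mathbf{PP}_6^{\Rightarrow},{\uparrow}\mathbf b\rangle$ is self-extensional.
   Context: Let $\mathcal{V}_6=\{\hat{\mathbf f},\mathbf f,\mathbf n,\mathbf b,\mathbf t,\hat{\mathbf t}\}$, partially ordered as a bounded distributive lattice by $\hat{\mathbf f}<\mathbf f<\mathbf n<\mathbf t<\hat{\mathbf t}$ and $\mathbf f<\mathbf b<\mathbf t$, with $\mathbf n,\mathbf b$ incomparable. $\mathbf{PP}_6$ is the algebra on $\mathcal V_6$ in the signature $\{\land,\lor,{\sim},\circ,\bot,\top\}$ where $\land,\lor$ are meet and join, $\bot=\hat{\mathbf f}$, $\top=\hat{\mathbf t}$, ${\sim}$ swaps $\mathbf f\leftrightarrow\mathbf t$ and $\hat{\mathbf f}\leftrightarrow\hat{\mathbf t}$ and fixes $\mathbf n,\mathbf b$, and ${\circ}a=\hat{\mathbf t}$ if $a\in\{\hat{\mathbf f},\hat{\mathbf t}\}$, ${\circ}a=\hat{\mathbf f}$ otherwise. ${\uparrow}\mathbf b=\{\mathbf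 b,\mathbf t,\hat{\mathbf t}\}$. Formulas are built from a countably infinite set of propositional variables. A PNmatrix $\langle\mathbf A,D\rangle$ consists of a multialgebra $\mathbf A$ (each $k$-ary connective $\copyright$ interpreted as a map $\copyright^{\mathbf A}\colon A^k\to\wp(A)$) and a set $D\subseteq A$ of designated values. A valuation is a map $h$ from formulas to $A$ with $h(\copyright(\varphi_1,\dots,\varphi_k))\in\copyright^{\mathbf A}(h(\varphi_1),\dots,h(\varphi_k))$ for all connectives. The Set-Set logic $\rhd$ determined by $\langle\mathbf A,D\rangle$: for sets of formulas $\Phi,\Psi$, $\Phi\rhd\Psi$ iff for every valuation $h$, either $h(\varphi)\notin D$ for some $\varphi\in\Phi$ or $h(\psi)\in D$ for some $\psi\in\Psi$. Write $\varphi\lhd\rhd\psi$ if $\{\varphi\}\rhd\{\psi\}$ and $\{\psi\}\rhd\{\varphi\}$. The logic is self-extensional if for every $k$-ary connective $\copyright$ of the signature, $\varphi_i\lhd\rhd\psi_i$ for all $1\le i\le k$ implies $\copyright(\varphi_1,\dots,\varphi_k)\lhd\rhd\copyright(\psi_1,\dots,\psi_k)$.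
   Formalization: The multioperation ⇒ is additionally required to have non-empty values a⇒b for all a,b; if empty values are allowed the claim fails (take a⇒b=∅ when a∉↑b or b∈↑b, and {f̂} otherwise: no valuations exist, so (A1) and (A2) both hold). *)

(* Defs.v *)
From HB Require Import structures.
From mathcomp Require Import all_boot all_order.
Set Implicit Arguments.
Unset Strict Implicit.
Unset Printing Implicit Defensive.

Record signature := Signature { conn : Type; arity : conn -> nat }.

Inductive formula (S : signature) : Type :=
  | Var of nat
  | App (c : conn S) of formula S ^ arity c.

(* Empty values are allowed: these are the "partial" multialgebras underlying
   PNmatrices. *)
Definition multialgebra (S : signature) (A : finType) : Type :=
  forall c : conn S, A ^ arity c -> {set A}.

Record PNmatrix (S : signature) (A : finType) := MkPNmatrix {
  interp : multialgebra S A;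
  designated : {set A} }.

Definition valuation (S : signature) (A : finType) (M : PNmatrix S A)
    (h : formula S -> A) : Prop :=
  forall (c : conn S) (phi : formula S ^ arity c),
    h (App phi) \in interp M [ffun i => h (phi i)].

Definition setset (S : signature) : Type :=
  (formula S -> Prop) -> (formula S -> Prop) -> Prop.

Definition logic_of (S : signature) (A : finType) (M : PNmatrix S A) :
    setset S :=
  fun Phi Psi => forall h, valuation M h ->
    (exists2 phi, Phi phi & h phi \notin designated M)
    \/ (exists2 psi, Psi psi & h psi \in designated M).

Definition interderivable (S : signature) (L : setset S)
    (phi psi : formula S) : Prop :=
  L (eq phi) (eq psi) /\ L (eq psi) (eq phi).

Definition self_extensional (S : signature) (L : setset S) : Prop :=
  forall (c : conn S) (phi psi : formula S ^ arity c),
    (forall i, interderivable L (phi i) (psi i)) ->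
    interderivable L (App phi) (App psi).

(* V_fh and V_th are the hatted values. *)
Inductive v6 := V_fh | V_f | V_n | V_b | V_t | V_th.

Definition v6_code (x : v6) : 'I_6 :=
  match x with
  | V_fh => @Ordinal 6 0 isT | V_f => @Ordinal 6 1 isT
  | V_n => @Ordinal 6 2 isT | V_b => @Ordinal 6 3 isT
  | V_t => @Ordinal 6 4 isT | V_th => @Ordinal 6 5 isT
  end.

Definition v6_decode (i : 'I_6) : v6 :=
  nth V_fh [:: V_fh; V_f; V_n; V_b; V_t; V_th] i.

Lemma v6_codeK : cancel v6_code v6_decode.
Proof. by case. Qed.

HB.instance Definition _ := Finite.copy v6 (can_type v6_codeK).

Definition v6_le (x y : v6) : bool :=
  match x, y with
  | V_fh, _ | _, V_th => true
  | V_f, (V_f | V_n | V_b | V_t) => true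
  | V_n, (V_n | V_t) => true
  | V_b, (V_b | V_t) => true
  | V_t, V_t => true
  | _, _ => false
  end.

(* The only incomparable pair is {V_n, V_b}. *)
Definition v6_meet (x y : v6) : v6 :=
  if v6_le x y then x else if v6_le y x then y else V_f.

Definition v6_join (x y : v6) : v6 :=
  if v6_le x y then y else if v6_le y x then x else V_t.

Fact v6_le_def x y : v6_le x y = (v6_meet x y == x).
Proof. by case: x; case: y. Qed.
Fact v6_meetC : commutative v6_meet. Proof. by case; case. Qed.
Fact v6_joinC : commutative v6_join. Proof. by case; case. Qed.
Fact v6_meetA : associative v6_meet. Proof. by case; case; case. Qed.
Fact v6_joinA : associative v6_join. Proof. by case; case; case. Qed.
Fact v6_joinKI y x : v6_meet x (v6_join x y) = x.
Proof. by case: x; case: y. Qed.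
Fact v6_meetKU y x : v6_join x (v6_meet x y) = x.
Proof. by case: x; case: y. Qed.
Fact v6_meetUl : left_distributive v6_meet v6_join.
Proof. by case; case; case. Qed.
Fact v6_meetxx : idempotent_op v6_meet. Proof. by case. Qed.
Fact v6_display : Order.disp_t. Proof. exact: (Order.Disp tt tt). Qed.

HB.instance Definition _ := Order.isMeetJoinDistrLattice.Build v6_display v6
  v6_le_def (fun _ _ => erefl) v6_meetC v6_joinC v6_meetA v6_joinA
  v6_joinKI v6_meetKU v6_meetUl v6_meetxx.

Fact v6_le0x (x : v6) : (V_fh <= x)%O. Proof. by case: x. Qed.
Fact v6_lex1 (x : v6) : (x <= V_th)%O. Proof. by case: x. Qed.
HB.instance Definition _ := Order.hasBottom.Build v6_display v6 v6_le0x.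
HB.instance Definition _ := Order.hasTop.Build v6_display v6 v6_lex1.

Definition v6_neg (x : v6) : v6 :=
  match x with
  | V_fh => V_th | V_f => V_t | V_n => V_n
  | V_b => V_b | V_t => V_f | V_th => V_fh
  end.

Definition v6_circ (x : v6) : v6 :=
  if x \in [set V_fh; V_th] then V_th else V_fh.

Definition up_b : {set v6} := [set x | (V_b <= x)%O].

Inductive pp_conn := And | Or | Neg | Circ | Bot | Top.

Definition pp_arity (c : pp_conn) : nat :=
  match c with And | Or => 2 | Neg | Circ => 1 | Bot | Top => 0 end.

Definition PP6 (c : pp_conn) : v6 ^ pp_arity c -> v6 :=
  match c return v6 ^ pp_arity c -> v6 with
  | And => fun a => (a ord0 `&` a ord_max)%O
  | Or => fun a => (a ord0 `|` a ord_max)%O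
  | Neg => fun a => v6_neg (a ord0)
  | Circ => fun a => v6_circ (a ord0)
  | Bot => fun _ => (\bot)%O
  | Top => fun _ => (\top)%O
  end.

(* The expanded signature: PP c is an old connective, Imp the new one. *)
Inductive ppi_conn := PP of pp_conn | Imp.

Definition ppi_sig : signature :=
  Signature (fun c => match c with PP c => pp_arity c | Imp => 2 end).

Definition PP6_imp (imp : v6 -> v6 -> {set v6}) : multialgebra ppi_sig v6 :=
  fun c => match c return v6 ^ @arity ppi_sig c -> {set v6} with
           | PP c => fun a => [set PP6 a]
           | Imp => fun a => imp (a ord0) (a ord_max)
           end.

Definition PP6_imp_matrix (imp : v6 -> v6 -> {set v6}) : PNmatrix ppi_sig v6 :=
  MkPNmatrix (PP6_imp imp) up_b.

Definition A1 (imp : v6 -> v6 -> {set v6}) : Prop :=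
  forall a b : v6, imp a b \subset up_b <-> (a \notin up_b \/ b \in up_b).

Definition A2 (imp : v6 -> v6 -> {set v6}) : Prop :=
  self_extensional (logic_of (PP6_imp_matrix imp)).

(* If a => b may be empty, A1 and A2 are jointly satisfiable: the witness
   below has no valuation at all (p => p never gets a value), so its logic
   relates any two sets of formulas. Hence non-existence can only be asserted
   of multioperations with non-empty values. *)
Lemma A1_A2_partial : exists imp : v6 -> v6 -> {set v6}, A1 imp /\ A2 imp.
Proof.
exists (fun a b => if (a \in up_b) && (b \notin up_b) then [set V_fh] else set0).
split=> [a b|].
  case: (boolP (a \in up_b)) => ha; case: (boolP (b \in up_b)) => hb /=;
    rewrite ?sub0set ?sub1set ?inE; split=> //; by [left | right | case].
have noval h : ~ valuation (PP6_imp_matrix (fun a b =>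
    if (a \in up_b) && (b \notin up_b) then [set V_fh] else set0)) h.
  move=> /(_ Imp [ffun=> Var _ 0]) /=.
  by rewrite !ffunE andbN inE.
by move=> c phi psi _; split=> h /noval.
Qed.

(* Main.v *)
(* Since the values of => are non-empty, a valuation may choose the value of
   each implication freely. Hence p => bot and (p /\ p) => bot, which must be
   interderivable, can only be so if a => bot avoids up_b entirely whenever a is
   in up_b. It follows that p /\ (p => bot) is interderivable with bot, so its
   image under o must be interderivable with o bot, i.e. always designated.
   But when p takes the value n, (A1) puts n => bot in up_b, so p /\ (p => bot)
   takes the value f or n, whose image under o is not designated. *)

Require Import Defs.
From mathcomp Require Import all_boot all_order.
Set Implicit Arguments.
Unset Strict Implicit.
Unset Printing Implicit Defensive.

Section TotalValuations.
Variables (S : signature) (A : finType) (M : PNmatrix S A).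
Hypothesis interp_neq0 : forall c (a : A ^ arity c), interp M a != set0.

(* [w] prescribes the value of each compound formula, and is followed wherever
   the multialgebra allows it. *)
Fixpoint eval (v : nat -> A) (w : formula S -> A) (phi : formula S) : A :=
  match phi with
  | Var n => v n
  | App c psi =>
      let s := interp M [ffun i => eval v w (psi i)] in
      let x := w (App psi) in
      if x \in s then x else odflt x [pick y in s]
  end.

(** Since [interp_neq0] excludes empty values, the fallback [pick] always succeeds and the default
    of [odflt] is never reached. *)
Lemma eval_valuation v w : valuation M (eval v w).
Proof.
move=> c phi /=; case: ifP => // _.
case: pickP => [y //|s0].
have /set0Pn[x] := interp_neq0 [ffun i => eval v w (phi i)].
by have /= -> := s0 x.
Qed.

Lemma eval_prescribed v w c (phi : formula S ^ arity c) :
  w (App phi) \in interp M [ffun i => eval v w (phi i)] ->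
  eval v w (App phi) = w (App phi).
Proof. by move=> /= ->. Qed.

End TotalValuations.

Lemma logic_of1 (S : signature) (A : finType) (M : PNmatrix S A) phi psi :
  logic_of M (eq phi) (eq psi) <->
  forall h, valuation M h -> h phi \in designated M -> h psi \in designated M.
Proof.
split=> [L h /L[[_ <- /negP//]|[_ <- //]]|L h hV].
have [/(L h hV)|] := boolP (h phi \in designated M).
  by right; exists psi.
by left; exists phi.
Qed.

Local Notation fml := (formula ppi_sig).

Definition pair2 (T : Type) (x y : T) : T ^ 2 :=
  [ffun i => if i == ord0 then x else y].

Definition fimp (p q : fml) : fml := @App ppi_sig Imp (pair2 p q).
Definition fand (p q : fml) : fml := @App ppi_sig (PP And) (pair2 p q).
Definition fcirc (p : fml) : fml := @App ppi_sig (PP Circ) [ffun=> p].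
(** [Bot] is nullary: the variable merely fills a function with empty domain. *)
Definition fbot : fml := @App ppi_sig (PP Bot) [ffun=> Var _ 0].

Section Expansion.
Variable imp : v6 -> v6 -> {set v6}.
Let M := PP6_imp_matrix imp.

Lemma eval_imp v w p q (h := eval M v w) :
  w (fimp p q) \in imp (h p) (h q) -> h (fimp p q) = w (fimp p q).
Proof. by move=> wI; apply: eval_prescribed; rewrite /= !ffunE. Qed.

Section ValuationRules.
Variables (h : fml -> v6) (hV : valuation M h).

Lemma val_imp p q : h (fimp p q) \in imp (h p) (h q).
Proof. by have := hV (c := Imp) (pair2 p q); rewrite /= !ffunE. Qed.

Lemma val_and p q : h (fand p q) = v6_meet (h p) (h q).
Proof.
by have := hV (c := PP And) (pair2 p q); rewrite /= inE !ffunE => /eqP.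
Qed.

Lemma val_circ p : h (fcirc p) = v6_circ (h p).
Proof.
by have := hV (c := PP Circ) [ffun=> p]; rewrite /= inE !ffunE => /eqP.
Qed.

Lemma val_bot : h fbot = V_fh.
Proof. by have := hV (c := PP Bot) [ffun=> Var _ 0]; rewrite /= inE => /eqP. Qed.

End ValuationRules.

Hypothesis imp_neq0 : forall a b, imp a b != set0.
Hypothesis impA1 : A1 imp.
Hypothesis impA2 : A2 imp.

Lemma interderivable_fimpl p p' q :
  interderivable (logic_of M) p p' ->
  interderivable (logic_of M) (fimp p q) (fimp p' q).
Proof.
move=> pp'; apply: (impA2 (c := Imp)) => i.
by rewrite !ffunE; case: ifP => // _; split; apply/logic_of1.
Qed.

Lemma interderivable_fcirc p p' :
  interderivable (logic_of M) p p' ->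
  interderivable (logic_of M) (fcirc p) (fcirc p').
Proof.
by move=> pp'; apply: (impA2 (c := PP Circ)) => i; rewrite !ffunE.
Qed.

Lemma interp_PP6_imp_neq0 c (a : v6 ^ @arity ppi_sig c) : interp M a != set0.
Proof.
case: c a => [c|] a /=; last exact: imp_neq0.
by apply/set0Pn; exists (PP6 a); rewrite inE.
Qed.

(** Two formulas [fimp p fbot] and [fimp (fand p p) fbot] have antecedents of equal value, so they
    can only be told apart by syntax: a variable as antecedent selects [x], a compound one [y]. On
    the old connectives the interpretation is a singleton, which overrides the prescription. *)
Definition prescribe (x y : v6) (phi : fml) : v6 :=
  match phi with
  | App Imp psi => if psi ord0 is Var _ then x else y
  | _ => x
  end.

Lemma imp_bot_undesignated a x :
  a \in up_b -> x \in imp a V_fh -> x \notin up_b.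
Proof.
move=> aD xI; apply/negP=> xD.
(* (A1) gives just one undesignated [y]; with [x] designated, one valuation can give [x] and [y] to
   two interderivable implications. *)
have /subsetPn[y yI yD] : ~~ (imp a V_fh \subset up_b).
  apply/negP=> /impA1; rewrite aD => -[//|].
  by rewrite inE.
pose p : fml := Var _ 0.
pose h := eval M (fun=> a) (prescribe x y).
have hV : valuation M h := eval_valuation interp_PP6_imp_neq0 _ _.
have hp : h p = a by [].
have hpp : h (fand p p) = a by rewrite (val_and hV) hp v6_meetxx.
have hx : h (fimp p fbot) = x.
  have -> : x = prescribe x y (fimp p fbot) by rewrite /= ffunE.
  apply: eval_imp; rewrite -/h hp (val_bot hV).
  by rewrite /= ffunE.
have hy : h (fimp (fand p p) fbot) = y.
  have -> : y = prescribe x y (fimp (fand p p) fbot) by rewrite /= ffunE.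
  apply: eval_imp; rewrite -/h hpp (val_bot hV).
  by rewrite /= ffunE.
have pE : interderivable (logic_of M) p (fand p p).
  by split; apply/logic_of1 => k kV; rewrite (val_and kV) v6_meetxx.
have [/logic_of1/(_ h hV)] := interderivable_fimpl fbot pE.
by rewrite hx hy => /(_ xD); rewrite [_ \in _](negbTE yD).
Qed.

Lemma no_implication : False.
Proof.
pose p : fml := Var _ 0.
pose phi := fand p (fimp p fbot).
have phi_bot : interderivable (logic_of M) phi fbot.
  split; apply/logic_of1 => k kV; last by rewrite (val_bot kV) inE.
  have := val_imp kV p fbot; rewrite (val_bot kV) (val_and kV).
  (* One factor of the meet is always undesignated, and [up_b] is upward closed, so the meet is
     undesignated too. *)
  have [kpD /(imp_bot_undesignated kpD)|] := boolP (k p \in up_b).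
    by rewrite !inE; case: (k p); case: (k (fimp _ _)).
  by rewrite !inE; case: (k p); case: (k (fimp _ _)).
have [_ /logic_of1 circ_phi] := interderivable_fcirc phi_bot.
(* The variable needs an undesignated value other than [V_fh]: the meet would then be [V_fh], which
   [v6_circ] sends to [V_th]. The second [V_n] is only a default for compound formulas. *)
pose h := eval M (fun=> V_n) (fun=> V_n).
have hV : valuation M h := eval_valuation interp_PP6_imp_neq0 _ _.
have := circ_phi h hV; rewrite !(val_circ hV).
rewrite (val_bot hV) (val_and hV) -/p.
have hp : h p = V_n by [].
have /subsetP/(_ _ (val_imp hV p fbot)) : imp (h p) (h fbot) \subset up_b.
  by apply/impA1; left; rewrite hp inE.
rewrite hp /v6_circ !inE.
by case: (h (fimp _ _)) => // _ /(_ isT).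
Qed.

End Expansion.

Theorem theorem4p1 :
  ~ exists imp : v6 -> v6 -> {set v6},
      [/\ forall a b : v6, imp a b != set0, A1 imp & A2 imp].
Proof. by case=> imp [imp_neq0 impA1 impA2]; apply: (@no_implication imp). Qed.
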